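(* Consider the block algorithm with FTPL described in the context, for Precision@$n$ ($1\le n\le m$) with relevance feedback on the top $k$ ranked items at the end of each round ($1\le k\le m$), with number of blocks $K$ of order $\frac{m^{1/3}T^{2/3}}{\lceil m/k\rceil^{2/3}}$ and $\epsilon$ of order $\frac{1}{\sqrt{mK}}$. Then for any sequence of relevance vectors $R_1,\dots,R_T\in\{0,1\}^m$, $$\max_\sigma\sum_{t=1}^T\mathrm{Precision@}n(\sigma,R_t)-\mathbb{E}\Big[\sum_{t=1}^T\mathrm{Precision@}n(\sigma_t,R_t)\Big]\ \le\ O\big(n\,m^{1/3}\lceil m/k\rceil^{1/3}T^{2/3}\big).$$ Precisely: for all constants $0<a_1\le a_2$ there is a constant $c$, depending only on $a_1,a_2$, such that for all $m,n,k,T$, all admissible $K$ with $a_1 \le K\lceil m/k\rceil^{2/3}/(m^{1/3}T^{2/3})\le a_2$, and all $\epsilon$ with $a_1\le \epsilon\sqrt{mK}\le a_2$, the left-hand side is at most $c\,n\,m^{1/3}\lceil m/k\rceil^{1/3}T^{2/3}$.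
   Context: A permutation $\sigma$ of the items $1,\dots,m$ maps ranks to items, $\sigma^{-1}$ maps items to ranks; $\mathrm{Precision@}n(\sigma,R)=\sum_{i=1}^m\mathbb{1}(\sigma^{-1}(i)\le n)R(i)$ (a gain). Online game with oblivious adversary over $T$ rounds: at round $t$ the learner outputs $\sigma_t$, gains $\mathrm{Precision@}n(\sigma_t,R_t)$ and observes only $R_t(\sigma_t(1)),\dots,R_t(\sigma_t(k))$ (top $k$ feedback). Algorithm (RTop-kF with Follow The Perturbed Leader), with parameters $K$, $\epsilon>0$. Divide $\{1,\dots,T\}$ into $K$ equal sized consecutive blocks $B_1,\dots,B_K$; $K$ is admissible if it is a positive integer dividing $T$ with $T/K\ge\lceil m/k\rceil$. Divide the items into $\lceil m/k\rceil$ cells of $k$ distinct items each (the last may have fewer). Set $\hat s_0=\mathbf{0}\in\mathbb{R}^m$. For $i=1,\dots,K$: select time points $i_1,\dots,i_{\lceil m/k\rceil}$ from $B_i$ uniformly at random without replacement. For $t\in B_i$: if $t=i_j$ (exploration), output any permutation placing the items of the $j$th cell in the top positions and observe their relevances; otherwise (exploitation) sample $p_t$ uniformly from $[0,1/\epsilon]^m$ (independently) and output $\sigma_t=M(\hat s_{i-1}+p_t)$, where $M(y)=\arg\min_\sigma \sigma^{-1}\cdot y$. At the end of block $i$ let $\hat R_i\in\mathbb{R}^m$ be the vector of the $m$ relevances collected in the exploration rounds of the block, and set $\hat s_i=\hat s_{i-1}+\hat R_i$. *)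

(* Defs.v *)
(* MathComp-Analysis.  Items, ranks, cells, blocks and rounds are numbered from
   0 by ordinals, except that [rank] below takes values in 1, ..., m. *)
From HB Require Import structures.
From mathcomp Require Import all_boot all_order all_algebra all_fingroup.
From mathcomp Require Import all_classical all_reals all_analysis.

Set Implicit Arguments.
Unset Strict Implicit.
Unset Printing Implicit Defensive.

Import Order.TTheory GRing.Theory Num.Theory.
Import numFieldNormedType.Exports.

Local Open Scope classical_set_scope.
Local Open Scope ring_scope.

Section Ranking.
Variable m : nat.

(* [s : 'S_m] maps ranks to items, so [s^-1] maps items to ranks. *)
Definition rank (s : 'S_m) (x : 'I_m) : nat := ((s^-1)%g x).+1.

Definition precision_at (n : nat) (s : 'S_m) (r : 'I_m -> bool) : nat :=
  (\sum_(x < m) (rank s x <= n) * r x)%N.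

Definition best_gain (n T : nat) (Rel : 'I_T -> 'I_m -> bool) : nat :=
  (\max_(s : 'S_m) \sum_(t < T) precision_at n s (Rel t))%N.

Definition rank_dot (R : realType) (s : 'S_m) (y : 'rV[R]_m) : R :=
  \sum_(x < m) (rank s x)%:R * y ord0 x.

(* The tie-breaking rule is arbitrary. *)
Definition is_argmin_oracle (R : realType) (M : 'rV[R]_m -> 'S_m) : Prop :=
  forall y s, rank_dot (M y) y <= rank_dot s y.

End Ranking.

Definition ceil_div (m k : nat) : nat := ((m + k.-1) %/ k)%N.

Definition admissible (m k T K : nat) : bool :=
  [&& (0 < K)%N, (K %| T)%N & (ceil_div m k <= T %/ K)%N].

Definition block (T K : nat) (b : 'I_K) : {set 'I_T} :=
  [set t : 'I_T | (t %/ (T %/ K))%N == b].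

(* All cells but the last have k items; the last one has the remaining
   m - (ceil_div m k - 1) * k items. *)
Definition is_cell_division (m k : nat) (cell : 'I_m -> 'I_(ceil_div m k)) : Prop :=
  forall j : 'I_(ceil_div m k), (j.+1 < ceil_div m k)%N ->
    #|[pred x | cell x == j]| = k.

(* The sequences of c distinct rounds of block b: the possible outcomes of
   drawing c rounds of the block without replacement. *)
Definition schedules (T K c : nat) (b : 'I_K) : {set {ffun 'I_c -> 'I_T}} :=
  [set f : {ffun 'I_c -> 'I_T} | injectiveb f && [forall j, f j \in block T b]].

Section Probability.
Context {d : measure_display} {Omega : measurableType d} {R : realType}.
Variable P : probability Omega R.

Definition mutually_independent (I : finType) (F : I -> set (set Omega)) : Prop :=
  forall (J : {set I}) (E : I -> set Omega), (forall i, i \in J -> F i (E i)) ->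
    P (\bigcap_(i in [set i | i \in J]) E i) = (\prod_(i in J) P (E i))%E.

Lemma inv_pos (eps : R) : 0 < eps -> 0 < eps^-1.
Proof. by rewrite invr_gt0. Qed.

(* The uniform law on the cube [0, 1/eps]^m, given by its values on boxes. *)
Definition uniform_on_cube (m : nat) (eps : R) (eps0 : 0 < eps)
    (X : Omega -> m.-tuple R) : Prop :=
  forall A : 'I_m -> set R, (forall x, measurable (A x)) ->
    P [set w | forall x, A x (tnth (X w) x)] =
    (\prod_(x < m) uniform_prob (inv_pos eps0) (A x))%E.

End Probability.

Section Algorithm.
Variables (m k T K : nat).
Let c := ceil_div m k.
Variables (R : realType) (cell : 'I_m -> 'I_c) (Rel : 'I_T -> 'I_m -> bool).

(* [tau b j] is the round of block b in which cell j is explored. *)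
Definition Rhat (tau : 'I_K -> {ffun 'I_c -> 'I_T}) (b : 'I_K) : 'rV[R]_m :=
  \row_x (Rel (tau b (cell x)) x)%:R.

(* The cumulative estimate available during block b. *)
Definition shat (tau : 'I_K -> {ffun 'I_c -> 'I_T}) (b : 'I_K) : 'rV[R]_m :=
  \sum_(b' < K | (b' < b)%N) Rhat tau b'.

(* [sigma t] is the output of a run of the block algorithm with exploration
   rounds [tau] and perturbations [p].  In an exploration round the items of the
   cell have to be among the k observed ones; the permutation is otherwise
   arbitrary, and may depend on everything else. *)
Record is_block_ftpl (d : measure_display) (Omega : measurableType d)
    (P : probability Omega R) (eps : R) (eps0 : 0 < eps)
    (M : 'rV[R]_m -> 'S_m)
    (tau : 'I_K -> Omega -> {ffun 'I_c -> 'I_T})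
    (p : 'I_T -> {RV P >-> m.-tuple R})
    (sigma : 'I_T -> Omega -> 'S_m) : Prop := IsBlockFTPL {
  tau_measurable : forall b f, measurable (tau b @^-1` [set f]);
  tau_schedule : forall b w, tau b w \in schedules T c b;
  tau_uniform : forall b f, f \in schedules T c b ->
    P (tau b @^-1` [set f]) = ((#|schedules T c b|%:R)^-1)%:E;
  p_uniform : forall t, uniform_on_cube P eps0 (p t);
  tau_p_independent : mutually_independent P
    (fun i : 'I_K + 'I_T => match i with
       | inl b => [set tau b @^-1` A | A in [set: set {ffun 'I_c -> 'I_T}]]
       | inr t => [set p t @^-1` B | B in (measurable : set (set (m.-tuple R)))]
     end);
  sigma_measurable : forall t s, measurable (sigma t @^-1` [set s]);
  sigma_exploration : forall b j w x, cell x = j ->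
    (rank (sigma (tau b w j) w) x <= k)%N;
  sigma_exploitation : forall b t w, t \in block T b ->
    (forall j, tau b w j != t) ->
    sigma t w =
      M (shat (fun b' => tau b' w) b + \row_x tnth (p t w) x)
}.

End Algorithm.

(* Main.v *)
Require Import Defs.
From HB Require Import structures.
From mathcomp Require Import all_boot all_order all_algebra all_fingroup.
From mathcomp Require Import all_classical all_reals all_analysis.
From mathcomp Require Import measurable_realfun ring lra.

(* Let Phi(y) be the largest sum of n coordinates of y.  A best-ranked set is a
   subgradient of Phi, so whatever the tie-breaking rule, the indicator that M(y)
   puts item x in the top n is at least the gap g_x(y) = Phi(y) - Phi(y - e_x),
   which is a measurable function of y.  This makes the expected gain of a round
   bounded below by an expression that is linear in the relevances, with
   coefficients depending only on the earlier blocks; and the round in which an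
   item is explored is uniform in its block, so within a block one may replace
   each relevance vector by the estimate of the block.

   For the estimates r_1, ..., r_K, with partial sums s_b, translating the cube
   [0, 1/eps]^m by v >= 0 changes the mean of a [0, B]-valued function by at most
   B eps |v|_1.  A translation by e_x turns g_x(s_b + p) into a forward difference
   and one by r_b turns sum_x r_b(x) g_x into at least
   Phi(s_b + r_b + p) - Phi(s_b + p); the latter telescopes.  This loses
   n / eps + 2 n m eps K, multiplied by the block length, to which every
   exploration round adds at most n. *)

Set Implicit Arguments.
Unset Strict Implicit.
Unset Printing Implicit Defensive.

Import Order.TTheory GRing.Theory Num.Theory.
Import numFieldNormedType.Exports.

Local Open Scope ring_scope.

(** * Sums of the n largest coordinates *)

Section TopSum.
Variables (R : realType) (m : nat).
Implicit Types (n : nat) (s : 'S_m) (y z r : 'rV[R]_m) (x : 'I_m).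

Definition topn n s y : R := \sum_x (rank s x <= n)%:R * y ord0 x.

(** This is Phi of the overview. The default value is itself one of the candidates, so the maximum
    is genuine even when all of them are negative. *)
Definition maxtop n y : R := \big[Num.max/topn n 1%g y]_(s : 'S_m) topn n s y.

Definition unit_vec x : 'rV[R]_m := delta_mx ord0 x.

Lemma topnD n s y z : topn n s (y + z) = topn n s y + topn n s z.
Proof. by rewrite -big_split; apply: eq_bigr => x _; rewrite mxE mulrDr. Qed.

Lemma topnN n s y : topn n s (- y) = - topn n s y.
Proof. by rewrite -sumrN; apply: eq_bigr => x _; rewrite mxE mulrN. Qed.

Lemma topn_unit n s x : topn n s (unit_vec x) = (rank s x <= n)%:R.
Proof.
rewrite /topn (bigD1 x)//= big1 => [|x' /negPf xx']; rewrite !mxE ?eqxx ?mulr1 ?addr0//.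
by rewrite xx' mulr0.
Qed.

Lemma topn_le n s y z : (forall x, y ord0 x <= z ord0 x) -> topn n s y <= topn n s z.
Proof. by move=> yz; apply: ler_sum => x _; rewrite ler_wpM2l. Qed.

Lemma card_rank_le n s : (n <= m)%N -> (\sum_(x < m) (rank s x <= n))%N = n.
Proof.
move=> nm; rewrite (reindex_inj (@perm_inj _ s))/=.
under eq_bigr do rewrite /rank permK.
rewrite -[RHS]card_ord -[RHS]sum1_card (big_ord_widen m (fun=> 1%N) nm).
by rewrite [RHS]big_mkcond; apply: eq_bigr => i _; case: ltnP.
Qed.

Lemma topn_const n s (a : R) : (n <= m)%N -> topn n s (const_mx a) = n%:R * a.
Proof.
move=> nm; rewrite -{2}(card_rank_le s nm) natr_sum mulr_suml.
by apply: eq_bigr => x _; rewrite mxE.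
Qed.

Lemma topn_le_maxtop n s y : topn n s y <= maxtop n y.
Proof. exact: le_bigmax. Qed.

Lemma maxtopE n y : exists s, maxtop n y = topn n s y.
Proof.
rewrite /maxtop; elim/big_ind : _ => //; first by exists 1%g.
- move=> _ _ [s ->] [s' ->]; rewrite /Num.max; case: ifP => _; by [exists s'|exists s].
- by move=> s _; exists s.
Qed.

Lemma maxtop_le n y z : (forall x, y ord0 x <= z ord0 x) -> maxtop n y <= maxtop n z.
Proof.
move=> yz; have [s ->] := maxtopE n y.
exact: le_trans (topn_le n s yz) (topn_le_maxtop _ _ _).
Qed.

Lemma maxtopD_le n y z : maxtop n (y + z) <= maxtop n y + maxtop n z.
Proof.
have [s ->] := maxtopE n (y + z).
by rewrite topnD lerD// topn_le_maxtop.
Qed.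

Lemma maxtop_unit n x : 0 <= maxtop n (unit_vec x) <= 1.
Proof.
have [s ->] := maxtopE n (unit_vec x).
by rewrite topn_unit; case: (_ <= _)%N; rewrite ?ler01 ?lexx.
Qed.

Lemma rank_inj s : injective (rank s).
Proof. by move=> x x' [/val_inj /perm_inj]. Qed.

(** Exchange argument: swapping the two items in [M y] cannot decrease [rank_dot], and the change is
    the product of the difference of the ranks and that of the coordinates. *)
Lemma oracle_sorted (M : 'rV[R]_m -> 'S_m) y x x' : is_argmin_oracle M ->
  (rank (M y) x < rank (M y) x')%N -> y ord0 x' <= y ord0 x.
Proof.
move=> hM lt; have xx' : x != x' by apply/eqP => E; rewrite E ltnn in lt.
(* The ranking [M y] with the positions of [x] and [x'] exchanged, as [rs] confirms. *)
pose s := (tperm ((M y)^-1 x) ((M y)^-1 x') * M y)%g.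
have rs (z : 'I_m) : rank s z = rank (M y) (tperm x x' z).
  rewrite /rank /s invMg permM tpermV; congr _.+1; congr val.
  case: tpermP => [/perm_inj ->|/perm_inj ->|n1 n2]; rewrite ?tpermL ?tpermR//.
  by rewrite tpermD//; apply/eqP => E; subst z.
have split (F : 'I_m -> R) :
    \sum_z F z = F x + F x' + \sum_(z | (z != x) && (z != x')) F z.
  by rewrite (bigD1 x)//= (bigD1 x')/= 1?eq_sym// addrA.
have := hM y s; rewrite /rank_dot !split !rs tpermL tpermR.
under [X in _ <= _ + X]eq_bigr => z /andP[zx zx'] do
  rewrite rs tpermD 1?eq_sym//.
move: (\sum_(_ | _) _) => S; move: lt; rewrite -(ltr_nat R).
move: (rank _ x)%:R (rank _ x')%:R (y _ x) (y _ x') => a b c e ab.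
rewrite lerD2r => h.
rewrite -subr_ge0 -(pmulr_rge0 _ (x := b - a)) ?subr_gt0//.
by rewrite mulrBl !mulrBr; lra.
Qed.

(** Subtracting from every coordinate that of the item of rank [n] lowers all candidates by the same
    amount. By [oracle_sorted] the top [n] coordinates of [M y] are then nonnegative and the others
    nonpositive, so the comparison holds item by item. *)
Lemma oracle_topn (M : 'rV[R]_m -> 'S_m) n y : is_argmin_oracle M ->
  (0 < n <= m)%N -> topn n (M y) y = maxtop n y.
Proof.
move=> hM /andP[n0 nm]; apply/le_anti; rewrite topn_le_maxtop/=.
have [s ->] := maxtopE n y.
have n1m : (n.-1 < m)%N by rewrite prednK.
pose x0 := M y (Ordinal n1m).
have rx0 : rank (M y) x0 = n by rewrite /rank /x0 permK /= prednK.
have E s' : topn n s' y = topn n s' (y - const_mx (y ord0 x0)) + n%:R * y ord0 x0.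
  by rewrite -(topn_const s' _ nm) -topnD subrK.
rewrite !E lerD2r; apply: ler_sum => x _; rewrite !mxE.
have [xn|xn] := leqP (rank (M y) x) n.
- have ? : 0 <= y ord0 x - y ord0 x0.
    rewrite subr_ge0; have [E0|] := eqVneq (rank (M y) x) n.
      by have /rank_inj -> : rank (M y) x = rank (M y) x0 by rewrite rx0.
    by move=> neq; apply: oracle_sorted => //; rewrite rx0 ltn_neqAle neq.
  by rewrite mul1r; case: (_ <= _)%N; rewrite ?mul1r ?mul0r.
- have ? : y ord0 x - y ord0 x0 <= 0.
    by rewrite subr_le0; apply: oracle_sorted => //; rewrite rx0.
  by rewrite mul0r; case: (_ <= _)%N; rewrite ?mul1r ?mul0r.
Qed.

Definition topn_gap n x y : R := maxtop n y - maxtop n (y - unit_vec x).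

Lemma topn_gap_bounds n x y : 0 <= topn_gap n x y <= 1.
Proof.
have := maxtopD_le n (y - unit_vec x) (unit_vec x); rewrite subrK => h.
have /andP[_ h1] := maxtop_unit n x.
apply/andP; split; last by rewrite /topn_gap; lra.
rewrite subr_ge0 maxtop_le// => z.
by rewrite !mxE lerBlDr lerDl ler0n.
Qed.

(** The ranking [M y] remains a candidate for Phi at [y - unit_vec x], where it loses exactly its
    indicator at [x]. *)
Lemma topn_gap_oracle (M : 'rV[R]_m -> 'S_m) n x y : is_argmin_oracle M ->
  (0 < n <= m)%N -> topn_gap n x y <= (rank (M y) x <= n)%:R.
Proof.
move=> hM nm; rewrite /topn_gap -(oracle_topn y hM nm).
have := topn_le_maxtop n (M y) (y - unit_vec x).
by rewrite topnD topnN topn_unit; lra.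
Qed.

Lemma topn_vecE n s r : topn n s r = \sum_x r ord0 x * (rank s x <= n)%:R.
Proof. by apply: eq_bigr => x _; rewrite mulrC. Qed.

(** A ranking optimal at [y + r] is a candidate at [y], so its value on [r] bounds the increment.
    The minimum with [n] is kept because the cost of a translation is proportional to the sup bound
    of the function: this makes it [n] instead of [m]. *)
Lemma maxtop_increment_le n y r : (forall x, 0 <= r ord0 x <= 1) -> (n <= m)%N ->
  maxtop n (y + r) - maxtop n y <=
  Num.min n%:R (\sum_x r ord0 x * topn_gap n x (y + r + unit_vec x)).
Proof.
move=> r01 nm; have [s Es] := maxtopE n (y + r).
have : maxtop n (y + r) - maxtop n y <= topn n s r.
  by rewrite Es topnD; have := topn_le_maxtop n s y; lra.
move=> /le_trans; apply; rewrite le_min; apply/andP; split.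
  rewrite -[leRHS]mulr1 -(topn_const s _ nm); apply: topn_le => x.
  by rewrite mxE; case/andP: (r01 x).
rewrite topn_vecE; apply: ler_sum => x _; apply: ler_wpM2l.
  by case/andP: (r01 x).
(* At [y + r + unit_vec x] the gap is the forward difference of Phi at [y + r], which dominates the
   indicator of any ranking optimal there. *)
rewrite /topn_gap addrK Es -(topn_unit n s x).
by have := topn_le_maxtop n s (y + r + unit_vec x); rewrite topnD; lra.
Qed.

End TopSum.

(** * Translations of the uniform law on a cube *)


Section UniformLaw.
Local Open Scope classical_set_scope.
Variable R : realType.

(** The pushforward under the translation agrees with Lebesgue measure on half-open intervals, which
    determine it. *)
Lemma lebesgue_measure_translation (a : R) (A : set R) : measurable A ->
  (@lebesgue_measure R) ((fun x => x + a) @^-1` A) = lebesgue_measure A.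
Proof.
move=> mA; rewrite -[LHS]/(pushforward lebesgue_measure
  ((fun x => x + a) : _ -> measurableTypeR R) A).
have ma : measurable_fun setT ((fun x => x + a) : R -> R).
  exact: measurable_funD.
apply/esym/lebesgue_measure_unique => //= _ [[u v]] _ <-.
rewrite /pushforward.
have -> : (fun x => x + a) @^-1` `]u, v] = `]u - a, v - a].
  by apply/seteqP; split => x /=; rewrite !in_itv/= ltrBlDr lerBrDr.
by rewrite !lebesgue_measure_itv/= !lte_fin ltrD2r -!EFinB opprB addrA subrK.
Qed.

Lemma uniform_prob_sub (b : R) (b0 : 0 < b) (A : set R) : measurable A ->
  A `<=` `[0, b] -> uniform_prob b0 A = (b^-1%:E * lebesgue_measure A)%E.
Proof.
move=> mA Ab; rewrite /uniform_prob -integral_cst//; apply: eq_integral => x.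
by rewrite inE => /Ab; rewrite /= in_itv/= /uniform_pdf subr0 => ->.
Qed.

End UniformLaw.

(** * Boxes and translations in the space of tuples *)

Section Tuples.
Local Open Scope classical_set_scope.
Variables (R : realType) (m : nat).
Local Notation mR := (m.-tuple R).

Definition box (A : 'I_m -> set R) : set mR := [set u | forall x, A x (tnth u x)].

Lemma measurable_box (A : 'I_m -> set R) : (forall x, measurable (A x)) ->
  measurable (box A).
Proof.
move=> mA; have -> : box A = \bigcap_(x in setT) ((@tnth m R)^~ x @^-1` A x).
  by apply/seteqP; split=> u uA x; [move=> _|]; exact: uA.
apply: fin_bigcap_measurable => // x _; rewrite -[X in measurable X]setTI.
exact: measurable_tnth.
Qed.

(** Boxes are closed under intersection and generate the product sigma-algebra. *)
Lemma measure_box_unique (m1 m2 : {measure set mR -> \bar R}) :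
  (m1 setT < +oo)%E ->
  (forall A, (forall x, measurable (A x)) -> m1 (box A) = m2 (box A)) ->
  forall B, measurable B -> m1 B = m2 B.
Proof.
move=> fin12 E12.
pose G := [set B | exists2 A, (forall x, measurable (A x)) & B = box A].
have GT : G setT.
  by exists (fun=> setT) => //; apply/seteqP; split.
apply: (@measure_unique _ _ _ G (fun=> setT)) => //.
- apply/seteqP; split; last first.
    apply: smallest_sub; first exact: sigma_algebra_measurable.
    by move=> _ [A mA ->]; exact: measurable_box.
  apply: smallest_sub; first exact: smallest_sigma_algebra.
  move=> B; rewrite -bigcup_seq => -[x _ [Y mY <-]]; apply: sub_sigma_algebra.
  (* A condition on one coordinate is a box whose other sides are the whole line. *)
  exists (fun x' => if x' == x then Y else setT) => [x'|]; first by case: ifP.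
  rewrite setTI; apply/seteqP; split => u /=.
    by move=> uY x'; case: eqP => // ->.
  by move/(_ x); rewrite eqxx.
- move=> _ _ [A mA ->] [A' mA' ->]; exists (fun x => A x `&` A' x) => [x|].
    exact: measurableI.
  by apply/seteqP; split => u /= => [[uA uA'] x|uAA']; [split|split => x; case: (uAA' x)].
- exact: bigcup_const.
- by move=> _ [A mA ->]; exact: E12.
Qed.

Definition shift_tuple (v : 'rV[R]_m) (u : mR) : mR :=
  [tuple tnth u x + v ord0 x | x < m].

Lemma measurable_shift_tuple v : measurable_fun setT (shift_tuple v).
Proof.
apply/measurable_fun_tnthP => x.
rewrite (_ : _ \o _ = fun u => tnth u x + v ord0 x); last first.
  by apply/funext => u /=; rewrite tnth_mktuple.
by apply: measurable_funD => //; exact: measurable_tnth.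
Qed.

HB.instance Definition _ v := isMeasurableFun.Build _ _ _ _ (shift_tuple v)
  (measurable_shift_tuple v).

End Tuples.

Section Subadditivity.
Local Open Scope classical_set_scope.

Lemma measure_bigsetU_le {d} {T : measurableType d} {R : realType}
    (mu : {measure set T -> \bar R}) (I : Type) (s : seq I) (F : I -> set T) :
  (forall i, measurable (F i)) ->
  (mu (\big[setU/set0]_(i <- s) F i) <= \sum_(i <- s) mu (F i))%E.
Proof.
move=> mF; elim: s => [|i s IH]; first by rewrite !big_nil measure0.
rewrite !big_cons; apply: le_trans (leeD2l (mu (F i)) IH).
by apply: measureU2 => //; exact: bigsetU_measurable.
Qed.

End Subadditivity.

(** * Comparison of the uniform law on a cube with its translate *)

Section CubeShift.
Local Open Scope classical_set_scope.
Context {d : measure_display} {Omega : measurableType d} {R : realType}.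
Variables (P : probability Omega R) (m : nat) (eps : R) (eps0 : 0 < eps).
Variables (X X' : {RV P >-> m.-tuple R}).
Hypotheses (uX : uniform_on_cube P eps0 X) (uX' : uniform_on_cube P eps0 X').
Variable v : 'rV[R]_m.
Hypothesis v0 : forall x, 0 <= v ord0 x.

(** The sides of the overlap of the cube and its translate by [v]; a side is empty when [v] exceeds
    the edge length there. *)
Let side x : set R := `[v ord0 x, eps^-1].
Let cube := box side.
Let Y : {mfun Omega >-> m.-tuple R} := shift_tuple v \o X.

Let mcube : measurable cube.
Proof. by apply: measurable_box => x; exact: measurable_itv. Qed.

(** On the overlap both laws are the same multiple of Lebesgue measure, by translation invariance on
    each side of a box. Two variables [X] and [X'] are allowed so that perturbations of different
    rounds can be exchanged. *)
Lemma law_shift_cube B : measurable B -> B `<=` cube ->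
  distribution P Y B = distribution P X' B.
Proof.
move=> mB Bc.
(* Restricting both laws to the overlap removes the condition on [B], so that it suffices to compare
   them on boxes. *)
suff : mrestr (distribution P Y) mcube B = mrestr (distribution P X') mcube B.
  by rewrite /mrestr setIidl.
apply: measure_box_unique => //.
  rewrite /= /mrestr; apply: le_lt_trans (ltry 1); apply: probability_le1.
  exact: measurableI.
move=> A mA; rewrite /= /mrestr.
have mAc x : measurable (A x `&` side x).
  by apply: measurableI => //; exact: measurable_itv.
have -> : box A `&` cube = box (fun x => A x `&` side x).
  by apply/seteqP; split => u /= => [[uA uc] x|h]; [split|split => x; case: (h x)].
rewrite /distribution /pushforward.
rewrite (_ : Y @^-1` _ = [set w | forall x, ((fun z => z + v ord0 x) @^-1`
    (A x `&` side x)) (tnth (X w) x)]); last first.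
  by apply/seteqP; split => w /= h x; have := h x; rewrite tnth_mktuple.
have mt x : measurable ((fun z => z + v ord0 x) @^-1`
    (A x `&` side x)).
  by rewrite -[X in measurable X]setTI; exact: measurable_funD.
rewrite [LHS](uX (A := fun x => (fun z => z + v ord0 x) @^-1` (A x `&` side x)))//.
rewrite [RHS](uX' (A := fun x => A x `&` side x))//; apply: eq_bigr => x _.
rewrite !uniform_prob_sub//.
- by rewrite lebesgue_measure_translation.
- by move=> z [_]; rewrite /side /= !in_itv/= => /andP[h ->]; rewrite (le_trans _ h).
- move=> z [_]; rewrite /side /= !in_itv/= => /andP[h1 h2].
  by have := v0 x; move: h1 h2; move: eps^-1 => e; lra.
Qed.

(** Union bound over coordinates: the translated coordinate [x] leaves its side with probability at
    most [eps * v ord0 x]. *)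
Lemma shift_escape : (P (Y @^-1` (~` cube)) <= (eps * \sum_x v ord0 x)%:E)%E.
Proof.
have mS x : measurable [set w | (~` side x) (tnth (Y w) x)].
  rewrite -[X in measurable X]setTI.
  have /measurable_fun_tnthP/(_ x) mYx : measurable_fun setT Y by exact: measurable_funP.
  by apply: mYx => //; apply: measurableC; exact: measurable_itv.
have h1 : (P (Y @^-1` (~` cube)) <=
    \sum_(x < m) P [set w | (~` side x) (tnth (Y w) x)])%E.
  apply: le_trans (measure_bigsetU_le P (index_enum 'I_m) mS).
  rewrite -bigcup_seq.
  apply: le_measure; rewrite ?inE.
  - rewrite -[X in measurable X]setTI; apply: measurable_funP => //.
    exact: measurableC.
  - by apply: fin_bigcup_measurable.
  move=> w /= /existsNP[x hx]; exists x => //=.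
  by rewrite mem_index_enum.
apply: (le_trans h1).
rewrite mulr_sumr -sumEFin; apply: lee_sum => x _.
(* A box constrained in direction [x] only, so that the product formula for its probability reduces
   to one factor. *)
pose far x' : set R := if x' == x then ~` `[0, eps^-1 - v ord0 x] else setT.
have mfar x' : measurable (far x').
  rewrite /far; case: ifP => // _.
  by apply: measurableC; exact: measurable_itv.
have -> : [set w | (~` side x) (tnth (Y w) x)] =
    [set w | forall x', far x' (tnth (X w) x')].
  apply/seteqP; split => w /=.
    move=> h x'; rewrite /far; case: eqP => // ->.
    move: h; rewrite tnth_mktuple /side /= !in_itv/= => h; apply: contra_not h.
    by rewrite lerDr lerBrDr.
  move/(_ x); rewrite /far eqxx tnth_mktuple /side /= !in_itv/= => h.
  by apply: contra_not h; rewrite lerDr lerBrDr.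
rewrite (uX mfar) /far.
rewrite (bigD1 x)//= big1 ?mule1 ?eqxx; last first.
  by move=> x' /negPf ->; exact: probability_setT.
rewrite -[leLHS]/(uniform_prob (inv_pos eps0) _).
rewrite probability_setC; last exact: measurable_itv.
rewrite -[X in (1 - X)%E]/(uniform_prob (inv_pos eps0) _).
rewrite uniform_prob_sub; [|exact: measurable_itv|]; last first.
  move=> z /=; rewrite /side /= !in_itv/= => /andP[-> h2]; have := v0 x.
  by move: h2; move: eps^-1 => e; lra.
rewrite invrK lebesgue_measure_itv/= lte_fin subr_gt0.
(* If the shift is at least the edge length, the remaining interval has measure zero and the claimed
   bound is at least 1. *)
case: ltP => h.
  rewrite oppr0 adde0 -EFinM -EFinB lee_fin mulrBr divff ?gt_eqF//; lra.
rewrite mule0 sube0 lee_fin; move: h.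
by rewrite -(ler_pM2l eps0) divff ?gt_eqF.
Qed.

(** Split according to whether the translated point lies in the overlap. Inside, the laws agree and
    extending the domain only increases the integral; outside, [h] is at most [B] and [shift_escape]
    applies. *)
Lemma expectation_shift_le (h : m.-tuple R -> R) (B : R) :
  measurable_fun setT h -> (forall u, 0 <= h u <= B) ->
  (\int[P]_w (h (shift_tuple v (X w)))%:E <=
   \int[P]_w (h (X' w))%:E + (B * (eps * \sum_x v ord0 x))%:E)%E.
Proof.
move=> mh hB.
have h0 u : 0 <= h u by case/andP: (hB u).
have B0 : 0 <= B.
  by case/andP: (hB [tuple 0 | x < m]) => /le_trans; apply.
have mEh : measurable_fun setT (EFin \o h) by exact/measurable_EFinP.
have mY D : measurable D -> measurable (Y @^-1` D).
  by move=> mD; rewrite -[X in measurable X]setTI; exact: measurable_funP.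
have mX' D : measurable D -> measurable (X' @^-1` D).
  by move=> mD; rewrite -[X in measurable X]setTI; exact: measurable_funP.
have mhY : measurable_fun setT (fun w => (h (Y w))%:E).
  by apply/measurable_EFinP; apply: measurableT_comp mh _; exact: measurable_funP.
have mhX' : measurable_fun setT (fun w => (h (X' w))%:E).
  by apply/measurable_EFinP; apply: measurableT_comp mh _; exact: measurable_funP.
rewrite -[X in (\int[P]_(_ in X) _)%E](setvU (Y @^-1` cube)).
rewrite ge0_integral_setU//=; last 5 first.
- by apply: measurableC; exact: mY.
- exact: mY.
- by rewrite setvU.
- by move=> w _; rewrite lee_fin.
- by apply/disj_setPS => w [].
rewrite addeC leeD//.
  have pushE (Z : {RV P >-> m.-tuple R}) :
      (\int[distribution P Z]_(u in cube) (h u)%:E =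
       \int[P]_(w in Z @^-1` cube) (h (Z w))%:E)%E.
    rewrite ge0_integral_pushforward//.
      exact: measurable_funS mEh.
    by move=> u _; rewrite lee_fin.
  rewrite -[leLHS](pushE Y) (eq_measure_integral (distribution P X')); last first.
    by move=> A mA; exact: law_shift_cube.
  rewrite pushE.
  apply: ge0_subset_integral => //; first exact: mX'.
  by move=> w _; rewrite lee_fin.
apply: (@le_trans _ _ (\int[P]_(w in ~` (Y @^-1` cube)) (cst B%:E w))%E).
  apply: ge0_le_integral => //=.
  - by apply: measurableC; exact: mY.
  - by move=> w _; rewrite lee_fin.
  - exact: measurable_funS mhY.
  - by move=> w _; rewrite lee_fin; case/andP: (hB (Y w)).
rewrite integral_cst; last by apply: measurableC; exact: mY.
by rewrite EFinM lee_wpmul2l ?lee_fin//; exact: shift_escape.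
Qed.

End CubeShift.

(** * Expectations of bounded functions *)


Section BoundedExpectation.
Local Open Scope classical_set_scope.
Context {d : measure_display} {Omega : measurableType d} {R : realType}.
Variable P : probability Omega R.
Implicit Types (f g h : Omega -> R).

Definition bmeas f :=
  measurable_fun setT f /\ exists B, forall w, `|f w| <= B.

Definition Ex f : R := \int[P]_w f w.

Lemma bmeas_integrable f : bmeas f -> P.-integrable setT (EFin \o f).
Proof.
move=> [mf [B fB]]; apply: measurable_bounded_integrable => //.
  by rewrite (le_lt_trans (probability_le1 P _)) ?ltry.
exists B; split; first exact: num_real.
by move=> M BM w _ /=; rewrite (le_trans (fB w))// ltW.
Qed.

Lemma bmeas_cst (a : R) : bmeas (fun=> a).
Proof. by split; [exact: measurable_cst|exists `|a|]. Qed.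

Lemma bmeasD f g : bmeas f -> bmeas g -> bmeas (fun w => f w + g w).
Proof.
move=> [mf [B fB]] [mg [C gC]]; split; first exact: measurable_funD.
by exists (B + C) => w; rewrite (le_trans (ler_normD _ _))// lerD.
Qed.

Lemma bmeasM f g : bmeas f -> bmeas g -> bmeas (fun w => f w * g w).
Proof.
move=> [mf [B fB]] [mg [C gC]]; split; first exact: measurable_funM.
by exists (B * C) => w; rewrite normrM ler_pM.
Qed.

Lemma bmeasZ (a : R) f : bmeas f -> bmeas (fun w => a * f w).
Proof. by move=> bf; apply: bmeasM => //; exact: bmeas_cst. Qed.

Lemma bmeasB f g : bmeas f -> bmeas g -> bmeas (fun w => f w - g w).
Proof.
move=> bf bg; rewrite (_ : (fun w => _) = (fun w => f w + (-1) * g w)).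
  by apply: bmeasD => //; exact: bmeasZ.
by apply/funext => w; rewrite mulN1r.
Qed.

Lemma bmeas_sum (I : Type) (s : seq I) (Q : pred I) (F : I -> Omega -> R) :
  (forall i, bmeas (F i)) -> bmeas (fun w => \sum_(i <- s | Q i) F i w).
Proof.
move=> bF; elim: s => [|i s IH].
  by under eq_fun do rewrite big_nil; exact: bmeas_cst.
under eq_fun do rewrite big_cons.
by case: (Q i) => //; exact: bmeasD.
Qed.

Lemma bmeas_indic (A : set Omega) : measurable A -> bmeas (\1_A).
Proof.
move=> mA; split; first exact: measurable_indic.
by exists 1 => w; rewrite indicE; case: (_ \in _); rewrite ?normr1 ?normr0.
Qed.

Lemma Ex_cst (a : R) : Ex (fun=> a) = a.
Proof.
by rewrite /Ex /Rintegral integral_cst//= -[P _]/(P setT) probability_setT mule1.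
Qed.

Lemma ExD f g : bmeas f -> bmeas g -> Ex (fun w => f w + g w) = Ex f + Ex g.
Proof. by move=> bf bg; apply: RintegralD => //; exact: bmeas_integrable. Qed.

Lemma ExZ (a : R) f : bmeas f -> Ex (fun w => a * f w) = a * Ex f.
Proof. by move=> bf; apply: RintegralZl => //; exact: bmeas_integrable. Qed.

Lemma ExB f g : bmeas f -> bmeas g -> Ex (fun w => f w - g w) = Ex f - Ex g.
Proof. by move=> bf bg; apply: RintegralB => //; exact: bmeas_integrable. Qed.

Lemma Ex_sum (I : Type) (s : seq I) (Q : pred I) (F : I -> Omega -> R) :
  (forall i, bmeas (F i)) ->
  Ex (fun w => \sum_(i <- s | Q i) F i w) = \sum_(i <- s | Q i) Ex (F i).
Proof.
move=> bF; elim: s => [|i s IH].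
  by under [in LHS]eq_fun do rewrite big_nil; rewrite Ex_cst big_nil.
under [in LHS]eq_fun do rewrite big_cons.
rewrite big_cons; case: (Q i) => //.
by rewrite ExD ?IH//; exact: bmeas_sum.
Qed.

Lemma Ex_le f g : bmeas f -> bmeas g -> (forall w, f w <= g w) -> Ex f <= Ex g.
Proof.
by move=> bf bg fg; apply: le_Rintegral => //; exact: bmeas_integrable.
Qed.

Lemma Ex_fin f : bmeas f -> (\int[P]_w (f w)%:E = (Ex f)%:E)%E.
Proof.
move=> bf; rewrite /Ex /Rintegral fineK//.
by apply: integrable_fin_num => //; exact: bmeas_integrable.
Qed.

Lemma expectationE f : bmeas f -> ('E_P[f] = (Ex f)%:E)%E.
Proof. by move=> bf; rewrite unlock; exact: Ex_fin. Qed.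

(** Needed because a perturbation lies in its cube only almost surely. *)
Lemma Ex_ge_ae f (a : R) (N : set Omega) : bmeas f -> measurable N -> P N = 0%E ->
  (forall w, ~ N w -> a <= f w) -> a <= Ex f.
Proof.
move=> bf mN N0 fa; rewrite -(Ex_cst a) /Ex /Rintegral.
rewrite (negligible_integral mN _ (bmeas_integrable bf))//.
rewrite (negligible_integral mN _ (bmeas_integrable (bmeas_cst a)))//.
apply: (@le_Rintegral _ _ _ P (setT `\` N)) => //.
- exact: measurableD.
- apply: integrableS (bmeas_integrable (bmeas_cst a)) => //.
  exact: measurableD.
- apply: integrableS (bmeas_integrable bf) => //; exact: measurableD.
- by move=> w [_ /fa].
Qed.

(** Under [P] restricted to [A], the law of [X] is [P A] times its original law. *)
Lemma Ex_independent d' (T' : measurableType d') (X : {RV P >-> T'})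
    (A : set Omega) (h : T' -> R) (M : R) : measurable A ->
  (forall B, measurable B -> P (A `&` X @^-1` B) = (P A * P (X @^-1` B))%E) ->
  measurable_fun setT h -> (forall u, 0 <= h u <= M) ->
  Ex (fun w => \1_A w * h (X w)) = fine (P A) * Ex (fun w => h (X w)).
Proof.
move=> mA indep mh hM.
have PA0 : 0 <= fine (P A) by rewrite fine_ge0.
have h0 u : (0 <= (h u)%:E)%E by rewrite lee_fin; case/andP: (hM u).
have mEh : measurable_fun setT (EFin \o h) by exact/measurable_EFinP.
have mhX : measurable_fun setT (fun w => (h (X w))%:E).
  by apply/measurable_EFinP; apply: measurableT_comp mh _; exact: measurable_funP.
have PAE : ((fine (P A))%:E = P A)%E by rewrite fineK// fin_num_measure.
have bhX : bmeas (fun w => h (X w)).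
  split; first exact/measurable_EFinP.
  by exists M => w; rewrite ger0_norm; case/andP: (hM (X w)).
rewrite {1}/Ex /Rintegral.
have -> : (\int[P]_w (\1_A w * h (X w))%:E = \int[P]_(w in A) (h (X w))%:E)%E.
  rewrite [RHS]integral_mkcond; apply: eq_integral => w _.
  by rewrite patchE indicE; case: ifP; rewrite ?mul1r ?mul0r.
have -> : (\int[P]_(w in A) (h (X w))%:E =
    (fine (P A))%:E * \int[distribution P X]_u (h u)%:E)%E.
  rewrite (eq_measure_integral (mrestr P mA)); last first.
    by move=> B mB BA; rewrite /= /mrestr setIidl.
  (* The complement of [A] is null for the restricted measure, so the domain may be enlarged to the
     whole space before pushing forward along [X]. *)
  transitivity (\int[mrestr P mA]_w (h (X w))%:E)%E.
    rewrite [RHS](@ge0_negligible_integral _ _ _ _ _ (~` A))//=.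
    - by rewrite setTD setCK.
    - exact: measurableC.
    - by rewrite /mrestr setICl measure0.
  rewrite -(ge0_integral_mscale _ _ (NngNum PA0))//.
  rewrite -[LHS]/(\int[mrestr P mA]_(w in X @^-1` setT) ((EFin \o h) \o X) w)%E.
  rewrite -ge0_integral_pushforward//; last by move=> u _; exact: h0.
  apply: eq_measure_integral => B mB _.
  by rewrite /= /mscale /pushforward /mrestr /= PAE setIC indep.
have -> : (\int[distribution P X]_u (h u)%:E = \int[P]_w (h (X w))%:E)%E.
  exact: (ge0_integral_distribution X mEh h0).
by rewrite (Ex_fin bhX) -EFinM.
Qed.
End BoundedExpectation.

(** * Follow the perturbed leader *)

Section PerturbedLeader.
Context {d : measure_display} {Omega : measurableType d} {R : realType}.
Variables (P : probability Omega R) (m : nat) (eps : R) (eps0 : 0 < eps).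
Implicit Types (n : nat) (s r : 'rV[R]_m) (x : 'I_m).
Local Notation mR := (m.-tuple R).

Definition tuple_row (u : mR) : 'rV[R]_m := \row_x tnth u x.

Lemma tuple_row_shift r u : tuple_row (shift_tuple r u) = tuple_row u + r.
Proof. by apply/rowP => x; rewrite !mxE tnth_mktuple. Qed.

Lemma measurable_maxtop n s :
  measurable_fun setT (fun u => maxtop n (s + tuple_row u)).
Proof.
have mt (t : 'S_m) : measurable_fun setT (fun u => topn n t (s + tuple_row u)).
  apply: measurable_sum => x; apply: measurable_funM => //.
  under eq_fun do rewrite !mxE.
  by apply: measurable_funD => //; exact: measurable_tnth.
rewrite /maxtop; elim: (index_enum _) => [|t l IH].
  by under eq_fun do rewrite big_nil; exact: mt.
under eq_fun do rewrite big_cons.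
exact: measurable_maxr.
Qed.

Lemma measurable_topn_gap n x s :
  measurable_fun setT (fun u => topn_gap n x (s + tuple_row u)).
Proof.
apply: measurable_funB; first exact: measurable_maxtop.
under eq_fun do rewrite addrAC.
exact: measurable_maxtop.
Qed.

Lemma bmeas_topn_gap n x s (X : {RV P >-> mR}) :
  bmeas (fun w => topn_gap n x (s + tuple_row (X w))).
Proof.
split; first exact: measurableT_comp (measurable_topn_gap n x s) _.
exists 1 => w; have := topn_gap_bounds n x (s + tuple_row (X w)).
by case/andP => *; rewrite ger0_norm.
Qed.

(** By subadditivity the increment of Phi along [r] lies between [- maxtop n (- r)] and
    [maxtop n r]. *)
Lemma bmeas_maxtop_increment n s r (X : {RV P >-> mR}) :
  bmeas (fun w => maxtop n (s + r + tuple_row (X w)) - maxtop n (s + tuple_row (X w))).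
Proof.
split.
  by apply: measurable_funB; apply: measurableT_comp (measurable_maxtop n _) _.
exists (`|maxtop n r| + `|maxtop n (- r)|) => w.
set y := tuple_row _.
have := maxtopD_le n (s + y) r; have := maxtopD_le n (s + r + y) (- r).
rewrite [s + r + y]addrAC addrK ler_norml.
have := ler_norm (maxtop n r); have := ler_norm (maxtop n (- r)).
have := normr_ge0 (maxtop n r); have := normr_ge0 (maxtop n (- r)).
by move=> *; apply/andP; split; lra.
Qed.

Definition mean_gap (X : {RV P >-> mR}) n x s : R :=
  Ex P (fun w => topn_gap n x (s + tuple_row (X w))).

Lemma Ex_shift_le (X X' : {RV P >-> mR}) r (h : mR -> R) (B : R) :
  uniform_on_cube P eps0 X -> uniform_on_cube P eps0 X' ->
  (forall x, 0 <= r ord0 x) -> measurable_fun setT h -> (forall u, 0 <= h u <= B) ->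
  Ex P (fun w => h (shift_tuple r (X w))) <=
  Ex P (fun w => h (X' w)) + B * (eps * \sum_x r ord0 x).
Proof.
move=> uX uX' r0 mh hB.
have bh (Y : {mfun Omega >-> mR}) : bmeas (fun w => h (Y w)).
  split; first exact: measurableT_comp mh _.
  by exists B => w; have := hB (Y w); case/andP => *; rewrite ger0_norm.
have := expectation_shift_le uX uX' r0 mh hB.
rewrite (Ex_fin P (bh X')) -EFinD.
by rewrite (Ex_fin P (bh (shift_tuple r \o X))) lee_fin.
Qed.

Lemma mean_gap_shift (X X' : {RV P >-> mR}) n x s :
  uniform_on_cube P eps0 X -> uniform_on_cube P eps0 X' ->
  mean_gap X n x (s + unit_vec R x) <= mean_gap X' n x s + eps.
Proof.
move=> uX uX'; have := @Ex_shift_le X X' (unit_vec R x) _ 1 uX uX' _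
  (measurable_topn_gap n x s) (fun u => topn_gap_bounds _ _ _).
rewrite (bigD1 x)//= big1 => [|x' /negPf xx']; last by rewrite !mxE xx'.
rewrite !mxE !eqxx addr0 mulr1 mul1r /mean_gap.
under [in X in X -> _]eq_fun do rewrite tuple_row_shift addrA.
under [in X in _ -> X]eq_fun do rewrite addrAC.
by apply => x'; rewrite mxE; case: (_ && _).
Qed.

(** A translation by zero costs nothing; apply it in both directions. *)
Lemma mean_gap_law (X X' : {RV P >-> mR}) n x s :
  uniform_on_cube P eps0 X -> uniform_on_cube P eps0 X' ->
  mean_gap X n x s = mean_gap X' n x s.
Proof.
have le (Y Y' : {RV P >-> mR}) : uniform_on_cube P eps0 Y ->
    uniform_on_cube P eps0 Y' -> mean_gap Y n x s <= mean_gap Y' n x s.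
  move=> uY uY'; have := @Ex_shift_le Y Y' 0 _ 1 uY uY' _
    (measurable_topn_gap n x s) (fun u => topn_gap_bounds _ _ _).
  rewrite big1 => [|x' _]; last by rewrite mxE.
  rewrite !mulr0 addr0 /mean_gap.
  under [in X in X -> _]eq_fun do rewrite tuple_row_shift addr0.
  by apply => x'; rewrite mxE.
by move=> uX uX'; apply/le_anti; rewrite !le.
Qed.

(** Two kinds of translation are paid for. The one by [r] acts on a function truncated at [n] and
    costs at most [n * m * eps]. Those by unit vectors cost [eps] each, weighted by [r], hence at
    most [m * eps] in total, which is within the same bound as [n] is positive. *)
Lemma maxtop_increment_mean (X : {RV P >-> mR}) n s r :
  uniform_on_cube P eps0 X -> (0 < n <= m)%N -> (forall x, 0 <= r ord0 x <= 1) ->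
  Ex P (fun w => maxtop n (s + r + tuple_row (X w)) - maxtop n (s + tuple_row (X w)))
  <= \sum_x r ord0 x * mean_gap X n x s + 2 * n%:R * m%:R * eps.
Proof.
move=> uX /andP[n0 nm] r01.
have r0 x : 0 <= r ord0 x by case/andP: (r01 x).
pose gaps u := \sum_x r ord0 x * topn_gap n x (s + unit_vec R x + tuple_row u).
pose h u := Num.min n%:R (gaps u).
have mgaps : measurable_fun setT gaps.
  by apply: measurable_sum => x; apply: measurable_funM => //; exact: measurable_topn_gap.
have mh : measurable_fun setT h by exact: measurable_minr.
have hB u : 0 <= h u <= n%:R.
  rewrite ge_min lexx le_min ler0n/= andbT.
  apply: sumr_ge0 => x _; rewrite mulr_ge0//.
  by case/andP: (topn_gap_bounds n x (s + unit_vec R x + tuple_row u)).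
have bh (Y : {mfun Omega >-> mR}) : bmeas (fun w => h (Y w)).
  split; first exact: measurableT_comp mh _.
  by exists n%:R => w; have := hB (Y w); case/andP => *; rewrite ger0_norm.
have bg x : bmeas (fun w => r ord0 x * topn_gap n x (s + unit_vec R x + tuple_row (X w))).
  by apply: bmeasZ; exact: bmeas_topn_gap.
have sr : \sum_x r ord0 x <= m%:R.
  rewrite -[m in leRHS]card_ord -sum1_card natr_sum.
  by apply: ler_sum => x _; case/andP: (r01 x).
have step1 : Ex P (fun w =>
      maxtop n (s + r + tuple_row (X w)) - maxtop n (s + tuple_row (X w))) <=
    Ex P (fun w => h (shift_tuple r (X w))).
  apply: Ex_le; [exact: bmeas_maxtop_increment|exact: (bh (shift_tuple r \o X))|].
  move=> w; rewrite addrAC.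
  rewrite (le_trans (maxtop_increment_le _ r01 nm))// /h /gaps.
  rewrite le_eqVlt; apply/orP; left; apply/eqP; congr Num.min; apply: eq_bigr => x _.
  rewrite tuple_row_shift; congr (_ * topn_gap n x _).
  by rewrite -!addrA; congr (_ + _); rewrite addrA addrC.
have step2 := Ex_shift_le uX uX r0 mh hB.
have step3 : Ex P (fun w => h (X w)) <=
    \sum_x r ord0 x * mean_gap X n x (s + unit_vec R x).
  apply: (@le_trans _ _ (Ex P (fun w => gaps (X w)))).
    apply: Ex_le => [||w]; [exact: bh|exact: bmeas_sum|by rewrite ge_min lexx orbT].
  rewrite Ex_sum//; apply: ler_sum => x _; rewrite ExZ//; exact: bmeas_topn_gap.
have step4 : \sum_x r ord0 x * mean_gap X n x (s + unit_vec R x) <=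
    \sum_x r ord0 x * mean_gap X n x s + eps * m%:R.
  apply: (@le_trans _ _ (\sum_x r ord0 x * (mean_gap X n x s + eps))).
    by apply: ler_sum => x _; rewrite ler_wpM2l// mean_gap_shift.
  under eq_bigr do rewrite mulrDr.
  by rewrite big_split/= lerD2l -mulr_suml mulrC ler_wpM2l// ltW.
have step5 : n%:R * (eps * \sum_x r ord0 x) <= n%:R * (eps * m%:R).
  by rewrite !ler_wpM2l// ltW.
have step6 : eps * m%:R <= n%:R * (eps * m%:R).
  by rewrite ler_peMl ?ler1n// mulr_ge0// ltW.
have -> : 2 * n%:R * m%:R * eps = n%:R * (eps * m%:R) + n%:R * (eps * m%:R) by ring.
lra.
Qed.

Definition prefix_sum K (r : 'I_K -> 'rV[R]_m) (j : nat) : 'rV[R]_m :=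
  \sum_(b < K | (b < j)%N) r b.

Lemma prefix_sumS K (r : 'I_K -> 'rV[R]_m) (b : 'I_K) :
  prefix_sum r b.+1 = prefix_sum r b + r b.
Proof.
rewrite /prefix_sum (bigD1 b) ?ltnSn//= addrC; congr (_ + _).
by apply: eq_bigl => b'; rewrite ltnS andbC ltn_neqAle.
Qed.

(** A single perturbation [X] serves all blocks, since only means matter; the increments of Phi then
    telescope. The ranking [t] bounds the final value of Phi from below because [X] is nonnegative,
    and Phi of [X] alone is at most [n / eps]. *)
Lemma follow_perturbed_leader (X : {RV P >-> mR}) n K (r : 'I_K -> 'rV[R]_m) (t : 'S_m) :
  uniform_on_cube P eps0 X -> (0 < n <= m)%N ->
  (forall b x, 0 <= r b ord0 x <= 1) ->
  topn n t (\sum_b r b) - n%:R / eps - 2 * n%:R * m%:R * eps * K%:R <=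
  \sum_b \sum_x r b ord0 x * mean_gap X n x (prefix_sum r b).
Proof.
move=> uX nm r01; have /andP[n0 nm'] := nm.
pose S j := prefix_sum r j.
have tele y : \sum_(b < K) (maxtop n (S b + r b + y) - maxtop n (S b + y)) =
    maxtop n (\sum_b r b + y) - maxtop n y.
  under eq_bigr do rewrite /S -prefix_sumS.
  rewrite -(big_mkord xpredT (fun j => maxtop n (S j.+1 + y) - maxtop n (S j + y))).
  rewrite telescope_sumr// /S /prefix_sum.
  rewrite [X in _ - maxtop n (X + _)]big_pred0// add0r.
  by congr (maxtop n (_ + _) - _); apply: eq_bigl => b; rewrite ltn_ord.
have ub : Ex P (fun w =>
      maxtop n (\sum_b r b + tuple_row (X w)) - maxtop n (tuple_row (X w)))
    <= \sum_b \sum_x r b ord0 x * mean_gap X n x (S b) + 2 * n%:R * m%:R * eps * K%:R.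
  under [X in Ex P X]eq_fun do rewrite -tele.
  rewrite Ex_sum; last by move=> b; exact: bmeas_maxtop_increment.
  have -> : 2 * n%:R * m%:R * eps * K%:R = \sum_(b < K) 2 * n%:R * m%:R * eps.
    by rewrite sumr_const card_ord mulr_natr.
  by rewrite -big_split/=; apply: ler_sum => b _; exact: maxtop_increment_mean.
suff lb : topn n t (\sum_b r b) - n%:R / eps <=
    Ex P (fun w => maxtop n (\sum_b r b + tuple_row (X w)) - maxtop n (tuple_row (X w))).
  by rewrite /S in ub; lra.
pose inside : set mR := box (fun=> `[0, eps^-1]%classic).
have mi : measurable inside by apply: measurable_box => x; exact: measurable_itv.
have mXi : measurable (X @^-1` inside)%classic.
  by rewrite -[X in measurable X]setTI; exact: measurable_funP.
apply: (@Ex_ge_ae _ _ _ _ _ _ (~` (X @^-1` inside))%classic).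
- have := bmeas_maxtop_increment n 0 (\sum_b r b) X.
  by under eq_fun do rewrite !add0r.
- exact: measurableC.
- rewrite probability_setC//.
  have -> : P (X @^-1` inside)%classic = 1%E.
    rewrite -[LHS]/(P [set w | forall x, `[0, eps^-1]%classic (tnth (X w) x)]%classic).
    rewrite (uX (fun=> `[0, eps^-1]%classic)); last first.
      by move=> x; exact: measurable_itv.
    rewrite big1// => x _.
    by rewrite /uniform_prob integral_uniform_pdf1// invr_gt0.
  by rewrite subee.
move=> w /contrapT wi; set y := tuple_row (X w).
have y01 x : 0 <= y ord0 x <= eps^-1.
  by rewrite /y mxE; have := wi x; rewrite /= in_itv.
have h1 := topn_le_maxtop n t (\sum_b r b + y).
have h2 : 0 <= topn n t y.
  apply: sumr_ge0 => x _; have /andP[? _] := y01 x.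
  by rewrite mulr_ge0.
have h3 : maxtop n y <= n%:R / eps.
  have [t' ->] := maxtopE n y; rewrite -(topn_const t' _ nm'); apply: topn_le => x.
  by rewrite [leRHS]mxE; case/andP: (y01 x).
by rewrite topnD in h1; lra.
Qed.

End PerturbedLeader.

(** * Random schedules *)

Section Schedules.
Variables (R : realType) (T K c : nat).
Hypotheses (K0 : (0 < K)%N) (KT : (K %| T)%N).
Local Notation schedule := {ffun 'I_c -> 'I_T}.
Local Notation plan := {ffun 'I_K -> schedule}.

(** The product of the uniform laws on schedules, extended by zero to all functions so that sums
    range over a full finite type. *)
Definition plan_weight (f : plan) : R :=
  \prod_b if f b \in schedules T c b then (#|schedules T c b|%:R)^-1 else 0.

Lemma card_block (b : 'I_K) : #|block T b| = (T %/ K)%N.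
Proof.
have lt (i : 'I_(T %/ K)) : (b * (T %/ K) + i < T)%N.
  rewrite -[ltnRHS](divnK KT); apply: (@leq_trans (b.+1 * (T %/ K))).
    by rewrite mulSnr ltn_add2l.
  by rewrite mulnC leq_mul2l ltn_ord orbT.
rewrite -[RHS]card_ord -(card_imset _ (f := fun i => Ordinal (lt i))); last first.
  by move=> i i' [/addnI /val_inj].
apply: eq_card => t; rewrite inE; apply/eqP/imsetP => [tb|[i _ ->]] /=.
  have L0 : (0 < T %/ K)%N by rewrite divn_gt0// dvdn_leq// (leq_ltn_trans _ (ltn_ord t)).
  exists (Ordinal (ltn_pmod t L0)) => //; apply: val_inj => /=.
  by rewrite -tb -divn_eq.
have L0 : (0 < T %/ K)%N by rewrite (leq_ltn_trans _ (ltn_ord i)).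
by rewrite divnMDl// divn_small ?addn0.
Qed.

Lemma schedule_inP (b : 'I_K) (g : schedule) :
  reflect (injective g /\ forall j, g j \in block T b) (g \in schedules T c b).
Proof.
rewrite inE; apply: (iffP andP) => -[/injectiveP gi /forallP gb]; split=> //.
Qed.

Definition swap_rounds (b0 : 'I_K) (t t' : 'I_T) (f : plan) : plan :=
  [ffun b => if b == b0 then [ffun j => tperm t t' (f b j)] else f b].

Lemma swap_roundsK b0 t t' : involutive (swap_rounds b0 t t').
Proof.
move=> f; apply/ffunP => b; rewrite !ffunE; case: eqP => // _.
by apply/ffunP => j; rewrite !ffunE tpermK.
Qed.

Lemma tperm_block (b : 'I_K) (t t' u : 'I_T) :
  t \in block T b -> t' \in block T b ->
  (tperm t t' u \in block T b) = (u \in block T b).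
Proof. by move=> tb t'b; case: tpermP => [->|->|//]; rewrite tb t'b. Qed.

Lemma plan_weight_swap b0 t t' f : t \in block T b0 -> t' \in block T b0 ->
  plan_weight (swap_rounds b0 t t' f) = plan_weight f.
Proof.
move=> tb t'b; apply: eq_bigr => b _; rewrite ffunE; case: eqP => // ->.
congr (if _ then _ else _); apply/schedule_inP/schedule_inP => -[gi gb]; split.
- by move=> j j' ff; apply: gi; rewrite !ffunE ff.
- by move=> j; have := gb j; rewrite ffunE tperm_block.
- by move=> j j'; rewrite !ffunE => /perm_inj /gi.
- by move=> j; rewrite ffunE tperm_block.
Qed.

(* Swapping two rounds of the block inside the schedule preserves the weights,
   so the round explored for cell j is equidistributed over the block, even when
   weighted by a function of the other blocks. *)
Lemma schedule_average (b0 : 'I_K) (j : 'I_c) (A : plan -> R) (phi : 'I_T -> R) :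
  (forall f f' : plan, (forall b, b != b0 -> f b = f' b) -> A f = A f') ->
  (T %/ K)%:R * \sum_f plan_weight f * (A f * phi (f b0 j)) =
  (\sum_f plan_weight f * A f) * \sum_(t in block T b0) phi t.
Proof.
move=> hA.
(* The weight, under [A], of the plans that explore cell [j] in round [t]; by the swap it is
   constant on the block. *)
pose q t := \sum_f plan_weight f * A f * (f b0 j == t)%:R.
have qE t t' : t \in block T b0 -> t' \in block T b0 -> q t = q t'.
  move=> tb t'b; rewrite /q (reindex_inj (inv_inj (swap_roundsK b0 t t'))).
  apply: eq_bigr => f _; rewrite plan_weight_swap//; congr (_ * _ * _).
    by apply: hA => b /negPf bb; rewrite ffunE bb.
  by rewrite !ffunE eqxx ffunE -(inj_eq (@perm_inj _ (tperm t t'))) tpermK tpermL.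
have split psi : \sum_f plan_weight f * (A f * psi (f b0 j)) =
    \sum_(t in block T b0) psi t * q t.
  under [RHS]eq_bigr do rewrite mulr_sumr.
  rewrite exchange_big/=; apply: eq_bigr => f _.
  (* A plan that leaves the block here is not made of schedules and has weight zero. *)
  have [fb|fb] := boolP (f b0 j \in block T b0); last first.
    have -> : plan_weight f = 0.
      rewrite /plan_weight (bigD1 b0)//=; case: schedule_inP => [[_ /(_ j)]|_].
        by rewrite (negPf fb).
      by rewrite mul0r.
    by rewrite mul0r big1// => t _; rewrite !mul0r mulr0.
  rewrite (bigD1 (f b0 j))//= eqxx big1 => [|t /andP[_ tn]].
    by rewrite addr0 mulr1; ring.
  by rewrite eq_sym (negPf tn) !mulr0.
(* With [psi] equal to 1, the total weight is the sum of [q] over the block, that is [T %/ K] times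
   any single value of [q]. *)
have := split (fun=> 1); under eq_bigr do rewrite mulr1; move=> ->.
rewrite split mulr_sumr mulr_sumr; apply: eq_bigr => t tb.
rewrite mulrCA mulrC; congr (_ * _).
rewrite (eq_bigr (fun=> q t)) => [|t' t'b]; last by rewrite mul1r; exact: qE.
by rewrite sumr_const card_block mulr_natl.
Qed.

End Schedules.

(** * Regret of the block algorithm *)

Section BlockFTPL.
Context {d : measure_display} {Omega : measurableType d} {R : realType}.
Variables (P : probability Omega R) (m n k T K : nat) (eps : R) (eps0 : 0 < eps).
Let c := ceil_div m k.
Variables (cell : 'I_m -> 'I_c) (Rel : 'I_T -> 'I_m -> bool) (M : 'rV[R]_m -> 'S_m).
Variables (tau : 'I_K -> Omega -> {ffun 'I_c -> 'I_T}).
Variables (p : 'I_T -> {RV P >-> m.-tuple R}) (sigma : 'I_T -> Omega -> 'S_m).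
Hypotheses (nm : (0 < n <= m)%N) (K0 : (0 < K)%N) (KT : (K %| T)%N).
Hypothesis hM : is_argmin_oracle M.
Hypothesis run : is_block_ftpl cell Rel eps0 M tau p sigma.
Local Notation plan := {ffun 'I_K -> {ffun 'I_c -> 'I_T}}.
Implicit Types (f : plan) (b : 'I_K) (t : 'I_T) (x : 'I_m).

Definition plan_of (w : Omega) : plan := [ffun b => tau b w].

Definition plan_event f : set Omega := [set w | plan_of w = f]%classic.

Definition relevance t : 'rV[R]_m := \row_x (Rel t x)%:R.

Definition estimate f b : 'rV[R]_m := Rhat R cell Rel f b.

Lemma plan_eventE f :
  plan_event f = (\bigcap_(b in [set: 'I_K]) (tau b @^-1` [set f b]))%classic.
Proof.
apply/seteqP; split => w /=.
  by move=> <- b _; rewrite /= ffunE.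
by move=> h; apply/ffunP => b; rewrite ffunE; exact: h.
Qed.

Lemma measurable_plan_event f : measurable (plan_event f).
Proof.
rewrite plan_eventE; apply: fin_bigcap_measurable => // b _.
exact: (tau_measurable run).
Qed.

Lemma prob_tau b g : P (tau b @^-1` [set g])%classic =
  (if g \in schedules T c b then (#|schedules T c b|%:R)^-1 else 0)%:E.
Proof.
case: ifPn => gs; first exact: (tau_uniform run).
rewrite (_ : (_ @^-1` _)%classic = set0) ?measure0//.
apply/seteqP; split => // w /= E; have := tau_schedule run b w.
by rewrite E (negPf gs).
Qed.

Lemma prob_plan_perturbation f t (B : set (m.-tuple R)) : measurable B ->
  P (plan_event f `&` p t @^-1` B)%classic =
  ((plan_weight R f)%:E * P (p t @^-1` B)%classic)%E.
Proof.
move=> mB.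
(* Independence is used for the schedules of all blocks together with the perturbation of the one
   round [t]. *)
pose J : {set 'I_K + 'I_T} := [set i | if i is inr t' then t' == t else true].
pose E (i : 'I_K + 'I_T) : set Omega := match i with
  | inl b => (tau b @^-1` [set f b])%classic
  | inr t' => (p t' @^-1` B)%classic end.
have := tau_p_independent run (J := J) (E := E).
have -> : (\bigcap_(i in [set i | i \in J]) E i = plan_event f `&` p t @^-1` B)%classic.
  rewrite plan_eventE; apply/seteqP; split => w /=.
    move=> h; split; first by move=> b _; apply: (h (inl b)); rewrite /= inE.
    by apply: (h (inr t)); rewrite /= inE.
  by move=> [h1 h2] [b _|t' /=]; [exact: h1|rewrite inE => /eqP ->].
rewrite big_sumType/= => ->; last first.
  by move=> [b _|t' _]; [exists [set f b]%classic|exists B].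
congr (_ * _)%E.
  rewrite /plan_weight -prodEFin; apply: eq_big => b; first by rewrite inE.
  by move=> _; rewrite prob_tau.
by rewrite (eq_bigl (pred1 t)) ?big_pred1_eq// => t'; rewrite inE.
Qed.

Lemma prob_plan t f : P (plan_event f) = (plan_weight R f)%:E.
Proof.
have := prob_plan_perturbation f t measurableT.
by rewrite preimage_setT setIT probability_setT mule1.
Qed.

(** Only finitely many plans occur, so measurability and independence can be treated one plan at a
    time. *)
Lemma plan_split (h : plan -> m.-tuple R -> R) t w :
  h (plan_of w) (p t w) = \sum_(f : plan) (\1_(plan_event f) w : R) * h f (p t w).
Proof.
rewrite (bigD1 (plan_of w))//= big1 => [|f fw].
  by rewrite addr0 indicE mem_set// mul1r.
rewrite indicE memNset ?mul0r// /plan_event /= => E.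
by rewrite E eqxx in fw.
Qed.

Section PlanDependent.
Variables (h : plan -> m.-tuple R -> R) (B : R).
Hypothesis mh : forall f, measurable_fun setT (h f).
Hypothesis hB : forall f u, 0 <= h f u <= B.

Let bmeas_term t f : bmeas (fun w => (\1_(plan_event f) w : R) * h f (p t w)).
Proof.
apply: bmeasM; first by apply: bmeas_indic; exact: measurable_plan_event.
split; first exact: measurableT_comp (mh f) _.
by exists B => w; have := hB f (p t w); case/andP => *; rewrite ger0_norm.
Qed.

Lemma bmeas_plan t : bmeas (fun w => h (plan_of w) (p t w)).
Proof. by under eq_fun do rewrite plan_split; exact: bmeas_sum. Qed.

Lemma Ex_plan t : Ex P (fun w => h (plan_of w) (p t w)) =
  \sum_(f : plan) plan_weight R f * Ex P (fun w => h f (p t w)).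
Proof.
under eq_fun do rewrite plan_split.
rewrite Ex_sum//; apply: eq_bigr => f _.
rewrite (@Ex_independent _ _ _ P _ _ (p t) _ (h f) B)//.
- by rewrite (prob_plan t).
- exact: measurable_plan_event.
- by move=> D mD; rewrite (prob_plan t); exact: prob_plan_perturbation.
Qed.

End PlanDependent.

Lemma sum_plan_weight t : \sum_(f : plan) plan_weight R f = 1.
Proof.
have := @Ex_plan (fun _ _ => 1 : R) 1 _ _ t.
rewrite /= Ex_cst => ->; last first.
- by move=> f u; rewrite ler01 lexx.
- by move=> f; exact: measurable_cst.
by apply: eq_bigr => f _; rewrite mulr1.
Qed.

Lemma plan_weight_ge0 f : 0 <= plan_weight R f.
Proof. by apply: prodr_ge0 => b _; case: ifP. Qed.

Lemma precision_topn (s : 'S_m) t :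
  (precision_at n s (Rel t))%:R = topn n s (relevance t).
Proof.
rewrite /precision_at natr_sum; apply: eq_bigr => x _.
by rewrite natrM mxE.
Qed.

Lemma topn_relevance_le (s : 'S_m) t : topn n s (relevance t) <= n%:R.
Proof.
have /andP[_ nm'] := nm.
rewrite -[leRHS]mulr1 -(topn_const s _ nm'); apply: topn_le => x.
by rewrite !mxE; case: (Rel t x).
Qed.

Lemma block_index_subproof t : (t %/ (T %/ K) < K)%N.
Proof.
have L0 : (0 < T %/ K)%N by rewrite divn_gt0// dvdn_leq// (leq_ltn_trans _ (ltn_ord t)).
by rewrite ltn_divLR// mulnC divnK.
Qed.

Definition block_index t : 'I_K := Ordinal (block_index_subproof t).

Lemma sum_blocks (F : 'I_T -> R) :
  \sum_t F t = \sum_(b < K) \sum_(t in block T b) F t.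
Proof.
rewrite (partition_big block_index xpredT)//=; apply: eq_bigr => b _.
by apply: eq_bigl => t; rewrite inE -val_eqE.
Qed.

Lemma mem_block_index t : t \in block T (block_index t).
Proof. by rewrite inE. Qed.

(** Linear in the relevances of round [t], free of the oracle, and dependent on [f] only through the
    blocks before that of [t]. *)
Definition gain_bound t f (u : m.-tuple R) : R :=
  \sum_x (Rel t x)%:R *
    topn_gap n x (prefix_sum (estimate f) (block_index t) + tuple_row u).

Definition explored w t := [exists j, tau (block_index t) w j == t].

(** In an exploitation round the oracle dominates the gaps. In an exploration round the gain is
    nonnegative while the bound is at most [n]. *)
Lemma gain_bound_le w t :
  gain_bound t (plan_of w) (p t w) - n%:R * (explored w t)%:R <=
  (precision_at n (sigma t w) (Rel t))%:R.
Proof.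
have /andP[n0 nm'] := nm.
set y := prefix_sum (estimate (plan_of w)) (block_index t) + tuple_row (p t w).
have gM : gain_bound t (plan_of w) (p t w) <= topn n (M y) (relevance t).
  rewrite topn_vecE; apply: ler_sum => x _; rewrite mxE ler_wpM2l//.
  exact: topn_gap_oracle.
have [ex|/existsPn nex] := boolP (explored w t).
  by rewrite mulr1 (@le_trans _ _ 0)// subr_le0 (le_trans gM)// topn_relevance_le.
rewrite mulr0 subr0 (le_trans gM)//.
rewrite (sigma_exploitation run (mem_block_index t) nex) precision_topn.
have -> : y = shat R cell Rel (fun b' => tau b' w) (block_index t) +
    \row_x tnth (p t w) x.
  congr (_ + _); apply: eq_bigr => b _; apply/rowP => x.
  by rewrite !mxE ffunE.
exact: lexx.
Qed.

(** Count by pairs of a block and a cell, each of which designates one round. *)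
Lemma sum_explored w : \sum_t (explored w t)%:R <= (K * c)%:R :> R.
Proof.
apply: (@le_trans _ _ (\sum_t \sum_b \sum_(j < c) (tau b w j == t)%:R)).
  apply: ler_sum => t _; have [/existsP[j jt]|_] := boolP (explored w t); last first.
    by do 2 (apply: sumr_ge0 => ? _).
  rewrite (bigD1 (block_index t))//= (bigD1 j)//= jt -addrA lerDl addr_ge0//.
    by apply: sumr_ge0.
  by do 2 (apply: sumr_ge0 => ? _).
have -> : (K * c)%:R = \sum_(b < K) \sum_(j < c) (1 : R).
  by rewrite !sumr_const !card_ord -mulrnA mulnC.
rewrite exchange_big/=; apply: ler_sum => b _.
rewrite exchange_big/=; apply: ler_sum => j _.
rewrite (bigD1 (tau b w j))//= eqxx big1 ?addr0// => t /negPf.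
by rewrite eq_sym => ->.
Qed.

Definition gain w : R := (\sum_(t < T) precision_at n (sigma t w) (Rel t))%N%:R.

Lemma bmeas_gain : bmeas gain.
Proof.
rewrite /gain; under eq_fun do rewrite natr_sum.
apply: bmeas_sum => t.
(* The measurability of [sigma t] is known on its level sets, so decompose over the finitely many
   permutations. *)
rewrite (_ : (fun w => _) = (fun w => \sum_(s : 'S_m)
    (\1_(sigma t @^-1` [set s])%classic w : R) * (precision_at n s (Rel t))%:R)).
  apply: bmeas_sum => s; apply: bmeasM; last exact: bmeas_cst.
  by apply: bmeas_indic; exact: (sigma_measurable run).
apply/funext => w; rewrite (bigD1 (sigma t w))//= big1 => [|s sw].
  by rewrite addr0 indicE mem_set// mul1r.
rewrite indicE memNset ?mul0r//= => E.
by rewrite E eqxx in sw.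
Qed.

Lemma measurable_gain_bound t f : measurable_fun setT (gain_bound t f).
Proof.
apply: measurable_sum => x; apply: measurable_funM => //.
exact: measurable_topn_gap.
Qed.

Lemma gain_bound_bounds t f u : 0 <= gain_bound t f u <= m%:R.
Proof.
have g01 x := topn_gap_bounds n x (prefix_sum (estimate f) (block_index t) + tuple_row u).
apply/andP; split.
  by apply: sumr_ge0 => x _; rewrite mulr_ge0//; case/andP: (g01 x).
rewrite -[m in leRHS]card_ord -sum1_card natr_sum; apply: ler_sum => x _.
have /andP[? ?] := g01 x.
by case: (Rel t x); rewrite ?mul1r ?mul0r.
Qed.

(** The perturbation of round [t] is replaced by that of a fixed round [t0] with the same law, so
    the coefficients depend on [t] only through its block. *)
Lemma mean_gain_bound t t0 : Ex P (fun w => gain_bound t (plan_of w) (p t w)) =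
  \sum_(f : plan) plan_weight R f * \sum_x (Rel t x)%:R *
     mean_gap (p t0) n x (prefix_sum (estimate f) (block_index t)).
Proof.
rewrite (Ex_plan (measurable_gain_bound t) (gain_bound_bounds t)).
apply: eq_bigr => f _; congr (_ * _); rewrite Ex_sum => [|x].
  apply: eq_bigr => x _; rewrite ExZ; last exact: bmeas_topn_gap.
  by congr (_ * _); apply: (mean_gap_law _ _ (eps0 := eps0)); exact: (p_uniform run).
by apply: bmeasZ; exact: bmeas_topn_gap.
Qed.

Lemma prefix_estimate_local b f f' : (forall b', b' != b -> f b' = f' b') ->
  prefix_sum (estimate f) b = prefix_sum (estimate f') b.
Proof.
move=> ff; apply: eq_bigr => b' lt; apply/rowP => x; rewrite !mxE ff//.
by rewrite -val_eqE ltn_eqF.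
Qed.

(** The best gain and the mean of the lower bounds both become the block length times an average
    over plans of a quantity in the estimates; the bound for a fixed sequence is then applied plan
    by plan. *)
Lemma block_ftpl_regret :
  (0 < T)%N ->
  (best_gain n Rel)%:R - Ex P gain <=
  (T %/ K)%:R * (n%:R / eps + 2 * n%:R * m%:R * eps * K%:R) + n%:R * (K * c)%:R.
Proof.
move=> T0; pose t0 := Ordinal T0; pose L : R := (T %/ K)%:R.
pose alpha f b x := mean_gap (p t0) n x (prefix_sum (estimate f) b).
have bgb t : bmeas (fun w => gain_bound t (plan_of w) (p t w)).
  exact: bmeas_plan (measurable_gain_bound t) (gain_bound_bounds t) t.
have lower : \sum_t Ex P (fun w => gain_bound t (plan_of w) (p t w)) - n%:R * (K * c)%:R
    <= Ex P gain.
  rewrite -Ex_sum// -[n%:R * _](Ex_cst P) -ExB; [|exact: bmeas_sum|exact: bmeas_cst].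
  apply: Ex_le => [||w].
  - by apply: bmeasB; [exact: bmeas_sum|exact: bmeas_cst].
  - exact: bmeas_gain.
  rewrite /gain natr_sum.
  apply: (@le_trans _ _ (\sum_t (gain_bound t (plan_of w) (p t w) -
      n%:R * (explored w t)%:R))).
    rewrite sumrB lerD2l lerN2 -mulr_sumr ler_wpM2l//; exact: sum_explored.
  by apply: ler_sum => t _; exact: gain_bound_le.
(* In each block the relevances are averaged by [schedule_average] with coefficient [alpha], which
   ignores the schedule of that block. *)
have mean_bound : \sum_t Ex P (fun w => gain_bound t (plan_of w) (p t w)) =
    L * \sum_(f : plan) plan_weight R f * \sum_b \sum_x estimate f b ord0 x * alpha f b x.
  under eq_bigr do rewrite (mean_gain_bound _ t0).
  rewrite sum_blocks.
  transitivity (\sum_b \sum_x L * \sum_(f : plan) plan_weight R f *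
      (alpha f b x * (Rel (f b (cell x)) x)%:R)).
    apply: eq_bigr => b _.
    transitivity (\sum_(t in block T b) \sum_x
        (\sum_(f : plan) plan_weight R f * alpha f b x) * (Rel t x)%:R).
      apply: eq_bigr => t tb.
      have -> : block_index t = b.
        by move: tb; rewrite inE => /eqP tb; apply: val_inj.
      under eq_bigr do rewrite mulr_sumr.
      rewrite exchange_big/=; apply: eq_bigr => x _; rewrite mulr_suml.
      by apply: eq_bigr => f _; rewrite /alpha; ring.
    rewrite exchange_big/=; apply: eq_bigr => x _.
    rewrite (schedule_average K0 KT (cell x) (A := fun f => alpha f b x)
        (fun t => (Rel t x)%:R)).
      by rewrite mulr_sumr.
    by move=> f f' ff; rewrite /alpha (prefix_estimate_local ff).
  under eq_bigr do rewrite -mulr_sumr.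
  rewrite -mulr_sumr; congr (_ * _).
  under eq_bigr do rewrite exchange_big/=.
  rewrite exchange_big/=; apply: eq_bigr => f _.
  rewrite mulr_sumr; apply: eq_bigr => b _; rewrite mulr_sumr; apply: eq_bigr => x _.
  by rewrite /estimate /Rhat mxE; ring.
have [s bestE] : exists s : 'S_m,
    best_gain n Rel = (\sum_(t < T) precision_at n s (Rel t))%N.
  have card0 : (0 < #|'S_m|)%N by apply/card_gt0P; exists 1%g.
  have [s E] := @bigop.eq_bigmax _
    (fun s : 'S_m => \sum_(t < T) precision_at n s (Rel t))%N card0.
  by exists s.
(* The same averaging with coefficient 1, for a fixed optimal ranking [s]. *)
have best : (best_gain n Rel)%:R =
    L * \sum_(f : plan) plan_weight R f * topn n s (\sum_b estimate f b) :> R.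
  rewrite bestE natr_sum; under eq_bigr do rewrite precision_topn.
  rewrite sum_blocks.
  transitivity (\sum_b \sum_x (rank s x <= n)%:R *
      (L * \sum_(f : plan) plan_weight R f * (1 * (Rel (f b (cell x)) x)%:R))).
    apply: eq_bigr => b _; rewrite exchange_big/=; apply: eq_bigr => x _.
    rewrite (schedule_average K0 KT (cell x) (A := fun=> 1) (fun t => (Rel t x)%:R))//.
    under [in RHS]eq_bigr do rewrite mulr1.
    rewrite (sum_plan_weight t0) mul1r mulr_sumr.
    by apply: eq_bigr => t _; rewrite mxE.
  transitivity (\sum_b \sum_(f : plan) L * (plan_weight R f * topn n s (estimate f b))).
    apply: eq_bigr => b _.
    under [RHS]eq_bigr do rewrite mulr_sumr mulr_sumr.
    rewrite [RHS]exchange_big/=; apply: eq_bigr => x _.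
    rewrite !mulr_sumr; apply: eq_bigr => f _.
    by rewrite /estimate /Rhat mxE; ring.
  rewrite exchange_big/= mulr_sumr; apply: eq_bigr => f _.
  rewrite -mulr_sumr -mulr_sumr; congr (_ * (_ * _)).
  rewrite /topn exchange_big/=; apply: eq_bigr => x _.
  by rewrite summxE mulr_sumr.
have key : L * \sum_(f : plan) plan_weight R f * topn n s (\sum_b estimate f b) <=
    L * \sum_(f : plan) plan_weight R f * \sum_b \sum_x estimate f b ord0 x * alpha f b x
    + L * (n%:R / eps + 2 * n%:R * m%:R * eps * K%:R).
  set err : R := n%:R / eps + _.
  have -> : err = \sum_(f : plan) plan_weight R f * err.
    by rewrite -mulr_suml (sum_plan_weight t0) mul1r.
  rewrite -mulrDr ler_wpM2l// -big_split/=.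
  apply: ler_sum => f _; rewrite -mulrDr ler_wpM2l ?plan_weight_ge0//.
  have r01 b x : 0 <= estimate f b ord0 x <= 1.
    by rewrite mxE ler0n lern1; case: (Rel _ _).
  have := follow_perturbed_leader s (p_uniform run t0) nm r01.
  move=> h.
  by rewrite -lerBlDr /err opprD addrA.
rewrite best; move: lower; rewrite mean_bound; lra.
Qed.

End BlockFTPL.

(** * The choice of the parameters *)

(** Here [x], [y], [z] are the cube roots of [m], the number of cells and [T], and [q] is the square
    root of [m * K], which makes all exponents integers. The upper bound on [K] controls
    exploration, the lower bound the block length. *)
Lemma regret_rate (R : realType) (a1 a2 n K eps x y z q : R) :
  0 < a1 -> 0 <= n -> 0 < K -> 0 < eps -> 0 < x -> 0 < y -> 0 < z ->
  0 <= q -> q ^+ 2 = x ^+ 3 * K ->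
  a1 <= K * y ^+ 2 / (x * z ^+ 2) <= a2 -> a1 <= eps * q <= a2 ->
  z ^+ 3 / K * (n / eps + 2 * n * x ^+ 3 * eps * K) + n * (K * y ^+ 3) <=
  (a2 + (a1^-1 + 2 * a2) / Num.sqrt a1) * n * x * y * z ^+ 2.
Proof.
move=> a10 n0 K0 eps0 x0 y0 z0 q0 qE /andP[] h1 h2 /andP[h3 h4].
have [[[x0' y0'] z0'] K0'] := (ltW x0, ltW y0, ltW z0, ltW K0).
have xz0 : 0 < x * z ^+ 2 by rewrite mulr_gt0// exprn_gt0.
rewrite ler_pdivlMr// in h1; rewrite ler_pdivrMr// in h2.
have explore : n * (K * y ^+ 3) <= a2 * n * x * y * z ^+ 2.
  have -> : n * (K * y ^+ 3) = n * y * (K * y ^+ 2) by ring.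
  have -> : a2 * n * x * y * z ^+ 2 = n * y * (a2 * (x * z ^+ 2)) by ring.
  by rewrite ler_wpM2l// mulr_ge0// ltW.
have inv_eps : eps^-1 <= q / a1.
  by rewrite ler_pdivlMr// ler_pdivrMl.
(* The choice of [eps] balances the two terms: each is of order [n * q]. *)
have ftpl : n / eps + 2 * n * x ^+ 3 * eps * K <= n * q * (a1^-1 + 2 * a2).
  have -> : 2 * n * x ^+ 3 * eps * K = 2 * n * q * (eps * q).
    transitivity (2 * n * eps * (x ^+ 3 * K)); first by ring.
    by rewrite -qE; ring.
  have := ler_wpM2l n0 inv_eps.
  have := ler_wpM2l (mulr_ge0 (mulr_ge0 (ler0n R 2) n0) q0) h4.
  lra.
have sa0 : 0 < Num.sqrt a1 by rewrite sqrtr_gt0.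
(* After squaring and replacing [q ^+ 2], this is the lower bound on [K] times
   [x ^+ 2 * z ^+ 4 * K]. *)
have block_len : z ^+ 3 / K * q <= x * y * z ^+ 2 / Num.sqrt a1.
  rewrite ler_pdivlMr//.
  have -> : z ^+ 3 / K * q * Num.sqrt a1 = z ^+ 3 * q * Num.sqrt a1 / K by ring.
  rewrite ler_pdivrMr//.
  have sa0' := ltW sa0.
  have l0 : 0 <= z ^+ 3 * q * Num.sqrt a1 by rewrite !mulr_ge0 ?exprn_ge0.
  have r0 : 0 <= x * y * z ^+ 2 * K by rewrite !mulr_ge0 ?exprn_ge0.
  rewrite -ler_sqr ?nnegrE//.
  have -> : (z ^+ 3 * q * Num.sqrt a1) ^+ 2 = a1 * (x * z ^+ 2) * (x ^+ 2 * z ^+ 4 * K).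
    rewrite !exprMn qE sqr_sqrtr; last exact: ltW.
    by ring.
  have -> : (x * y * z ^+ 2 * K) ^+ 2 = K * y ^+ 2 * (x ^+ 2 * z ^+ 4 * K) by ring.
  by apply: ler_wpM2r h1; rewrite !mulr_ge0 ?exprn_ge0.
have a20 : 0 <= a2 := le_trans (le_trans (ltW a10) h3) h4.
have c0 : 0 <= a1^-1 + 2 * a2 by rewrite addr_ge0 ?mulr_ge0// invr_ge0 ltW.
have zK0 : 0 <= z ^+ 3 / K by rewrite divr_ge0 ?exprn_ge0.
have := ler_wpM2l zK0 ftpl.
have := ler_wpM2r (mulr_ge0 n0 c0) block_len.
lra.
Qed.

Lemma powR_third (R : realType) (a : R) : 0 <= a ->
  [/\ 0 <= a `^ (1 / 3), a = (a `^ (1 / 3)) ^+ 3 & a `^ (2 / 3) = (a `^ (1 / 3)) ^+ 2].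
Proof.
move=> a0; split; first exact: powR_ge0.
  by rewrite -powR_mulrn ?powR_ge0// -powRrM mul1r mulVf// powRr1.
by rewrite -powR_mulrn ?powR_ge0// -powRrM; congr (_ `^ _); field.
Qed.

Theorem corollary11 (R : realType) (a1 a2 : R) (ha1 : 0 < a1) (ha12 : a1 <= a2) :
  exists C : R,
  forall (m n k T K : nat) (eps : R) (eps0 : 0 < eps),
  (1 <= n <= m)%N -> (1 <= k <= m)%N ->
  admissible m k T K ->
  a1 <= K%:R * (ceil_div m k)%:R `^ (2 / 3) / (m%:R `^ (1 / 3) * T%:R `^ (2 / 3)) <= a2 ->
  a1 <= eps * Num.sqrt (m%:R * K%:R) <= a2 ->
  forall (Rel : 'I_T -> 'I_m -> bool)
    (cell : 'I_m -> 'I_(ceil_div m k)) (M : 'rV[R]_m -> 'S_m),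
  is_cell_division cell ->
  is_argmin_oracle M ->
  forall (d : measure_display) (Omega : measurableType d) (P : probability Omega R)
    (tau : 'I_K -> Omega -> {ffun 'I_(ceil_div m k) -> 'I_T})
    (p : 'I_T -> {RV P >-> m.-tuple R})
    (sigma : 'I_T -> Omega -> 'S_m),
  is_block_ftpl cell Rel eps0 M tau p sigma ->
  ((best_gain n Rel)%:R%:E
     - 'E_P[fun w => (\sum_(t < T) precision_at n (sigma t w) (Rel t))%N%:R]
   <= (C * n%:R * m%:R `^ (1 / 3) * (ceil_div m k)%:R `^ (1 / 3)
         * T%:R `^ (2 / 3))%:E)%E.
Proof.
(* The first summand pays for exploration. In the second, the numerator comes from the choice of
   [eps] and the square root from the lower bound on [K]. *)
exists (a2 + (a1^-1 + 2 * a2) / Num.sqrt a1).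
move=> m n k T K eps eps0 nm /andP[k0 km] /and3P[K0 KT cT] hK heps Rel cell M _ hM.
move=> d Omega P tau p sigma run.
set c := ceil_div m k in hK cT *.
have m0 : (0 < m)%N := leq_trans k0 km.
have c0 : (0 < c)%N.
  by rewrite /c /ceil_div divn_gt0// -{1}(prednK k0) -add1n leq_add2r.
(* A block has at least as many rounds as there are cells, and there is at least one cell. *)
have T0 : (0 < T)%N.
  by have := leq_trans c0 cT; rewrite divn_gt0// => /(leq_trans K0).
have gE : bmeas (gain n Rel sigma) := bmeas_gain n run.
rewrite (expectationE P gE) -EFinB lee_fin.
apply: (le_trans (block_ftpl_regret nm K0 KT hM run T0)).
have [x0 xE _] := powR_third (ler0n R m).
have [y0 yE y2E] := powR_third (ler0n R c).
have [z0 zE z2E] := powR_third (ler0n R T).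
have gt0 j : (0 < j)%N -> 0 < (j%:R : R) `^ (1 / 3).
  by move=> j0; rewrite powR_gt0// ltr0n.
have -> : (T %/ K)%:R = T%:R / K%:R :> R.
  by rewrite -[X in X%:R / _](divnK KT) natrM mulfK// pnatr_eq0 -lt0n.
rewrite natrM -/c [in leLHS]zE [X in _ * X * _ * _]xE [X in n%:R * (_ * X)]yE z2E.
apply: (@regret_rate R _ _ _ _ _ _ _ _ (Num.sqrt (m%:R * K%:R))) => //.
- by rewrite ltr0n.
- exact: gt0.
- exact: gt0.
- exact: gt0.
- by rewrite sqr_sqrtr ?mulr_ge0// -xE.
- by rewrite -y2E -z2E.
Qed.
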